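(* Let $D_2$ be the real Pimenov algebra with generators $\iota_1,\iota_2$, and let $G$ be the set of all $2\times 2$ matrices over $D_2$ of the form $$ g=\begin{pmatrix} e^{\iota_2\phi}&\iota_1(\beta+\iota_2\gamma)\\ -\iota_1(\beta-\iota_2\gamma)&e^{-\iota_2\phi} \end{pmatrix},\qquad \phi,\beta,\gamma\in\mathbf{R}. $$ Then $G$ is a subgroup of the group $SU(D_2)$ of $2\times 2$ matrices, and the group $G(2)$ of motions of the Galilean plane is isomorphic to $G$.
   Context: The Pimenov algebra $D_2=D_2(\mathbf{R})$ is the associative commutative unital real algebra with two generators $\iota_1,\iota_2$ satisfying $\iota_1^2=\iota_2^2=0$, $\iota_1\iota_2=\iota_2\iota_1\neq 0$; every element is uniquely of the form $a=a_0+a_1\iota_1+a_2\iota_2+a_3\iota_1\iota_2$ with $a_i\in\mathbf{R}$ (so $D_2$ has real basis $1,\iota_1,\iota_2,\iota_1\iota_2$). Functions of $D_2$-arguments are defined by Taylor expansion in the nilpotent part; in particular $e^{\iota_2\phi}=1+\iota_2\phi$ for $\phi\in\mathbf{R}$. The conjugation by $\iota_2$ is $\tilde a=a_0+a_1\iota_1-a_2\iota_2-a_3\iota_1\iota_2$. For a square matrix $A$ over $D_2$, $\tilde A$ is obtained by applying this conjugation to all entries, and the dual conjugate is $A^\star=\tilde A^{T}$ (transpose of $\tilde A$). $SU(D_2)$ (here for size $2\times2$) is the group, under matrix multiplication, of invertible $2\times 2$ matrices $A$ over $D_2$ such that $A^\star=A^{-1}$ and $\det A=1$. The group $G(2)$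 of motions of the Galilean plane is the group, under composition, of all transformations of $\mathbf{R}^2$ of the form $(x,y)\mapsto(x+a,\;y+\theta x+b)$ with $a,b,\theta\in\mathbf{R}$ (compositions of translations along the coordinate axes and Galilean rotations/boosts). Equivalently, it is the group of real matrices $\begin{pmatrix} 1 & 0 & 0 \\ a & 1 & 0 \\ b & \theta & 1 \end{pmatrix}$ under multiplication. *)

(* Defs.v *)
From HB Require Import structures.
From mathcomp Require Import all_boot all_order all_algebra.
From mathcomp Require Import ring.
From mathcomp Require Import all_classical all_reals all_analysis.
Import numFieldNormedType.Exports.

Set Implicit Arguments.
Unset Strict Implicit.
Unset Printing Implicit Defensive.

Import Order.TTheory GRing.Theory Num.Theory.
Local Open Scope classical_set_scope.
Local Open Scope ring_scope.

(* [Pimenov a0 a1 a2 a3] is a0 + a1 iota1 + a2 iota2 + a3 iota1 iota2;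
   see [pimenovE] below. *)
Record pimenov (R : realType) := Pimenov { pc0 : R; pc1 : R; pc2 : R; pc3 : R }.

Section Pimenov2.
Variable R : realType.
Local Notation D2 := (pimenov R).
Implicit Types (a b c : D2) (k l : R).

Definition pim_tuple a := (pc0 a, pc1 a, pc2 a, pc3 a).
Definition tuple_pim (t : R * R * R * R) : D2 :=
  Pimenov t.1.1.1 t.1.1.2 t.1.2 t.2.
Lemma pim_tupleK : cancel pim_tuple tuple_pim. Proof. by case. Qed.

HB.instance Definition _ := Equality.copy D2 (can_type pim_tupleK).
HB.instance Definition _ := Choice.copy D2 (can_type pim_tupleK).

Definition pim0 : D2 := Pimenov 0 0 0 0.
Definition pim1 : D2 := Pimenov 1 0 0 0.
Definition pimN a := Pimenov (- pc0 a) (- pc1 a) (- pc2 a) (- pc3 a).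
Definition pimD a b :=
  Pimenov (pc0 a + pc0 b) (pc1 a + pc1 b) (pc2 a + pc2 b) (pc3 a + pc3 b).
Definition pimM a b := Pimenov
  (pc0 a * pc0 b)
  (pc0 a * pc1 b + pc1 a * pc0 b)
  (pc0 a * pc2 b + pc2 a * pc0 b)
  (pc0 a * pc3 b + pc1 a * pc2 b + pc2 a * pc1 b + pc3 a * pc0 b).
Definition pimZ k a := Pimenov (k * pc0 a) (k * pc1 a) (k * pc2 a) (k * pc3 a).

Lemma pimDA : associative pimD.
Proof. by move=> [????] [????] [????]; rewrite /pimD /= !addrA. Qed.
Lemma pimDC : commutative pimD.
Proof. by move=> [a ???] [b ???]; rewrite /pimD /=; congr Pimenov; ring. Qed.
Lemma pimD0 : left_id pim0 pimD.
Proof. by move=> [????]; rewrite /pimD /= !add0r. Qed.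
Lemma pimDN : left_inverse pim0 pimN pimD.
Proof. by move=> [????]; rewrite /pimD /= !addNr. Qed.
HB.instance Definition _ := GRing.isZmodule.Build D2 pimDA pimDC pimD0 pimDN.

Lemma pimMA : associative pimM.
Proof. by move=> [????] [????] [????]; rewrite /pimM /=; congr Pimenov; ring. Qed.
Lemma pimMC : commutative pimM.
Proof. by move=> [????] [????]; rewrite /pimM /=; congr Pimenov; ring. Qed.
Lemma pim1M : left_id pim1 pimM.
Proof. by move=> [????]; rewrite /pimM /=; congr Pimenov; ring. Qed.
Lemma pimMDl : left_distributive pimM pimD.
Proof.
by move=> [????] [????] [????]; rewrite /pimM /pimD /=; congr Pimenov; ring.
Qed.
Lemma pim1_neq0 : pim1 != 0.
Proof. by apply/eqP => -[/eqP]; rewrite oner_eq0. Qed.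
HB.instance Definition _ :=
  GRing.Zmodule_isComNzRing.Build D2 pimMA pimMC pim1M pimMDl pim1_neq0.

Lemma pimZA k l a : pimZ k (pimZ l a) = pimZ (k * l) a.
Proof. by rewrite /pimZ /= !mulrA. Qed.
Lemma pim1Z : left_id 1 pimZ.
Proof. by move=> [????]; rewrite /pimZ /= !mul1r. Qed.
Lemma pimZDr : right_distributive pimZ +%R.
Proof. by move=> k a b; rewrite /pimZ /= !mulrDr. Qed.
Lemma pimZDl a : {morph pimZ^~ a : k l / k + l}.
Proof. by move=> k l; rewrite /pimZ /= !mulrDl. Qed.
HB.instance Definition _ :=
  GRing.Zmodule_isLmodule.Build R D2 pimZA pim1Z pimZDr pimZDl.
Lemma pimZAl k a b : k *: (a * b) = (k *: a) * b.
Proof. by case: a b => [????] [????]; congr Pimenov => /=; ring. Qed.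
HB.instance Definition _ := GRing.Lmodule_isLalgebra.Build R D2 pimZAl.
HB.instance Definition _ := GRing.Lalgebra_isComAlgebra.Build R D2.

Definition pim_unit : {pred D2} := fun a => pc0 a != 0.
Definition pimV a : D2 :=
  if pc0 a == 0 then a else
  Pimenov (pc0 a)^-1 (- pc1 a / pc0 a ^+ 2) (- pc2 a / pc0 a ^+ 2)
    (2%:R * pc1 a * pc2 a / pc0 a ^+ 3 - pc3 a / pc0 a ^+ 2).
Lemma pimVM : {in pim_unit, left_inverse 1 pimV *%R}.
Proof.
move=> a; rewrite /pimV unfold_in /pim_unit => a0; rewrite (negbTE a0).
by congr Pimenov => /=; field.
Qed.
Lemma pim_unitPl a b : b * a = 1 -> pim_unit a.
Proof.
move=> [ba _ _ _]; rewrite /pim_unit; apply/eqP => a0.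
by move/eqP: ba; rewrite a0 mulr0 eq_sym oner_eq0.
Qed.
Lemma pimV_out : {in [predC pim_unit], pimV =1 id}.
Proof. by move=> a; rewrite inE /= negbK /pimV => ->. Qed.
HB.instance Definition _ :=
  GRing.ComNzRing_hasMulInverse.Build D2 pimVM pim_unitPl pimV_out.

Definition iota1 : D2 := Pimenov 0 1 0 0.
Definition iota2 : D2 := Pimenov 0 0 1 0.

Lemma iota1_sq : iota1 ^+ 2 = 0. Proof. by congr Pimenov => /=; ring. Qed.
Lemma iota2_sq : iota2 ^+ 2 = 0. Proof. by congr Pimenov => /=; ring. Qed.
Lemma iota12_neq0 : iota1 * iota2 != 0.
Proof.
apply/eqP => /(congr1 (@pc3 R)) /= /eqP.
by rewrite !(mul0r, mul1r, add0r, addr0) oner_eq0.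
Qed.
Lemma pimenovE (x0 x1 x2 x3 : R) :
  Pimenov x0 x1 x2 x3 =
  x0%:A + x1 *: iota1 + x2 *: iota2 + x3 *: (iota1 * iota2).
Proof. by congr Pimenov => /=; ring. Qed.

Definition pim_nil a : D2 := a - (pc0 a)%:A.

Lemma pim_nilX3 a : pim_nil a ^+ 3 = 0.
Proof. by case: a => a0 a1 a2 a3; congr Pimenov => /=; ring. Qed.

(* The Taylor expansion at the real part; all the terms of order at least 3
   vanish by [pim_nilX3]. *)
Definition pim_ext (f : R -> R) a : D2 :=
  \sum_(k < 3) (derive1n k f (pc0 a) / k`!%:R) *: pim_nil a ^+ k.

Definition pim_exp : D2 -> D2 := pim_ext expR.

Lemma pim_exp_iota2 k : pim_exp (k *: iota2) = 1 + k *: iota2.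
Proof.
have dexp (n : nat) : derive1n n (@expR R) = expR.
  elim: n => // n IHn; rewrite /derive1n /= -/(derive1n n _) IHn.
  by apply/funext => x; rewrite derive1E derive_val.
rewrite /pim_exp /pim_ext !big_ord_recl big_ord0 !dexp /=.
rewrite mulr0 expR0 !fact0 ?invr1.
by congr Pimenov => /=; ring.
Qed.

Definition pim_conj a : D2 := Pimenov (pc0 a) (pc1 a) (- pc2 a) (- pc3 a).

Lemma pim_conj_is_zmod_morphism : zmod_morphism pim_conj.
Proof. by move=> [????] [????]; congr Pimenov => /=; ring. Qed.
Lemma pim_conj_is_monoid_morphism : monoid_morphism pim_conj.
Proof. by split=> [|[????] [????]]; congr Pimenov => /=; ring. Qed.
HB.instance Definition _ :=
  GRing.isZmodMorphism.Build D2 D2 pim_conj pim_conj_is_zmod_morphism.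
HB.instance Definition _ :=
  GRing.isMonoidMorphism.Build D2 D2 pim_conj pim_conj_is_monoid_morphism.

Definition dual_conj n (A : 'M[D2]_n) : 'M[D2]_n := (map_mx pim_conj A)^T.

Lemma dual_conj1 n : dual_conj 1%:M = 1%:M :> 'M[D2]_n.
Proof. by rewrite /dual_conj map_mx1 trmx1. Qed.
Lemma dual_conjM n (A B : 'M[D2]_n) :
  dual_conj (A *m B) = dual_conj B *m dual_conj A.
Proof. by rewrite /dual_conj map_mxM trmx_mul. Qed.
Lemma dual_conjK n : involutive (@dual_conj n).
Proof.
move=> A; apply/matrixP => i j; rewrite !mxE.
by case: (A i j) => [????]; rewrite /pim_conj /= !opprK.
Qed.

Definition special_unitary : {pred 'M[D2]_2} := [pred A : 'M[D2]_2 |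
  [&& A \in unitmx, dual_conj A == invmx A & \det A == 1]].

Lemma special_unitary1 : 1%:M \in special_unitary.
Proof. by rewrite inE /= unitmx1 dual_conj1 invmx1 det1 !eqxx. Qed.
Lemma special_unitaryM (A B : 'M[D2]_2) :
  A \in special_unitary -> B \in special_unitary ->
  A *m B \in special_unitary.
Proof.
rewrite !inE => /and3P[uA /eqP sA /eqP dA] /and3P[uB /eqP sB /eqP dB].
rewrite unitmx_mul uA uB dual_conjM sA sB det_mulmx dA dB mulr1 /=.
by rewrite eqxx andbT; apply/eqP; rewrite -[RHS]/((A * B)^-1) invrM.
Qed.
Lemma special_unitaryV (A : 'M[D2]_2) :
  A \in special_unitary -> invmx A \in special_unitary.
Proof.
rewrite !inE => /and3P[uA /eqP sA /eqP dA].
by rewrite unitmx_inv uA -{1}sA dual_conjK invmxK det_inv dA invr1 !eqxx.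
Qed.

(* The set [special_unitary], made into a group under matrix product. *)
Record SU2 := MkSU2 {
  SU2val :> 'M[D2]_2; SU2valP : SU2val \in special_unitary }.
HB.instance Definition _ := [isSub for SU2val].
HB.instance Definition _ := [Choice of SU2 by <:].

Definition SU2_one : SU2 := MkSU2 special_unitary1.
Definition SU2_mul (A B : SU2) : SU2 :=
  MkSU2 (special_unitaryM (SU2valP A) (SU2valP B)).
Definition SU2_inv (A : SU2) : SU2 := MkSU2 (special_unitaryV (SU2valP A)).

Lemma SU2_unit (A : SU2) : val A \in unitmx.
Proof. by case: A => A /= /and3P[]. Qed.
Lemma SU2_mulA : associative SU2_mul.
Proof. by move=> A B C; apply: val_inj; rewrite /= mulmxA. Qed.
Lemma SU2_mul1 : left_id SU2_one SU2_mul.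
Proof. by move=> A; apply: val_inj; rewrite /= mul1mx. Qed.
Lemma SU2_1mul : right_id SU2_one SU2_mul.
Proof. by move=> A; apply: val_inj; rewrite /= mulmx1. Qed.
Lemma SU2_mulV : left_inverse SU2_one SU2_inv SU2_mul.
Proof. by move=> A; apply: val_inj; rewrite /= mulVmx ?SU2_unit. Qed.
Lemma SU2_Vmul : right_inverse SU2_one SU2_inv SU2_mul.
Proof. by move=> A; apply: val_inj; rewrite /= mulmxV ?SU2_unit. Qed.
HB.instance Definition _ :=
  isGroup.Build SU2 SU2_mulA SU2_mul1 SU2_1mul SU2_mulV SU2_Vmul.

Definition mx22 (T : Type) (a b c d : T) : 'M[T]_2 :=
  \matrix_(i < 2, j < 2)
    if i == 0 then (if j == 0 then a else b) else (if j == 0 then c else d).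

Definition pim_galilei_mx (phi beta gamma : R) : 'M[D2]_2 := mx22
  (pim_exp (phi *: iota2))                 (iota1 * (beta%:A + gamma *: iota2))
  (- iota1 * (beta%:A - gamma *: iota2))   (pim_exp (- (phi *: iota2))).

Definition pim_galilei : set 'M[D2]_2 :=
  [set g | exists phi beta gamma : R, g = pim_galilei_mx phi beta gamma].

Definition galilei_map (a b theta : R) (p : R * R) : R * R :=
  (p.1 + a, p.2 + theta * p.1 + b).

Definition is_motion (f : R * R -> R * R) : Prop :=
  exists a b theta : R, f = galilei_map a b theta.

(* The group G(2) of motions of the Galilean plane, with composition. *)
Record motion := MkMotion {
  motion_fun :> R * R -> R * R; motionP : `[< is_motion motion_fun >] }.
HB.instance Definition _ := [isSub for motion_fun].
HB.instance Definition _ := [Choice of motion by <:].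

Lemma is_motion_id : `[< is_motion id >].
Proof.
apply/asboolP; exists 0, 0, 0; apply/funext => -[x y].
by rewrite /galilei_map /= mul0r !addr0.
Qed.
Lemma is_motion_comp f g :
  `[< is_motion f >] -> `[< is_motion g >] -> `[< is_motion (f \o g) >].
Proof.
move=> /asboolP[a [b [t ->]]] /asboolP[a' [b' [t' ->]]].
apply/asboolP; exists (a' + a), (b' + b + t * a'), (t' + t).
by apply/funext => -[x y]; rewrite /galilei_map /=; congr pair; ring.
Qed.

(* The parameters a, b, theta are read off the images of (0, 0) and (1, 0). *)
Definition motion_inv_fun (f : R * R -> R * R) : R * R -> R * R :=
  let: (a, b) := f (0, 0) in
  let theta := (f (1, 0)).2 - b in
  galilei_map (- a) (theta * a - b) (- theta).

Lemma is_motion_inv (f : motion) : `[< is_motion (motion_inv_fun f) >].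
Proof.
apply/asboolP; rewrite /motion_inv_fun; case: (motion_fun f _) => a b.
by do 3 eexists.
Qed.

Definition motion_one : motion := MkMotion is_motion_id.
Definition motion_mul (f g : motion) : motion :=
  MkMotion (is_motion_comp (motionP f) (motionP g)).
Definition motion_inv (f : motion) : motion := MkMotion (is_motion_inv f).

Lemma motion_mulA : associative motion_mul.
Proof. by move=> f g h; apply: val_inj. Qed.
Lemma motion_mul1 : left_id motion_one motion_mul.
Proof. by move=> f; apply: val_inj. Qed.
Lemma motion_1mul : right_id motion_one motion_mul.
Proof. by move=> f; apply: val_inj. Qed.
Lemma motion_mulV : left_inverse motion_one motion_inv motion_mul.
Proof.
move=> [f fP]; apply: val_inj => /=; move/asboolP: fP => [a [b [t ->]]].
by apply/funext => -[x y]; rewrite /motion_inv_fun /galilei_map /=; congr pair; ring.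
Qed.
Lemma motion_Vmul : right_inverse motion_one motion_inv motion_mul.
Proof.
move=> [f fP]; apply: val_inj => /=; move/asboolP: fP => [a [b [t ->]]].
by apply/funext => -[x y]; rewrite /motion_inv_fun /galilei_map /=; congr pair; ring.
Qed.
HB.instance Definition _ := isGroup.Build motion
  motion_mulA motion_mul1 motion_1mul motion_mulV motion_Vmul.

End Pimenov2.

Arguments special_unitary R : clear implicits.
Arguments pim_galilei R : clear implicits.

(* Main.v *)
(* In the parameters of [pim_galilei_mx], matrix multiplication is
   (phi, beta, gamma) (phi', beta', gamma') =
   (phi + phi', beta + beta', gamma + gamma' + phi beta' - beta phi'),
   the Heisenberg law with the alternating cocycle, while composing motions is
   (a, b, theta) (a', b', theta') =
   (a + a', b + b' + theta a', theta + theta').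
   The substitution phi = theta, beta = a, gamma = 2 b - theta a turns the
   second law into the first. *)

Require Import Defs.
From HB Require Import structures.
From mathcomp Require Import all_boot all_order all_algebra.
From mathcomp Require Import ring.
From mathcomp Require Import all_classical all_reals all_analysis.

Import GRing.Theory.

Local Open Scope classical_set_scope.
Local Open Scope ring_scope.

Section Pimenov.
Variable R : realType.
Implicit Types phi beta gamma a b theta : R.

(** In real coordinates, identities between these matrices reduce to polynomial identities within
    reach of [ring]. *)
Lemma pim_galilei_mxE phi beta gamma :
  pim_galilei_mx phi beta gamma =
  mx22 (Pimenov 1 0 phi 0) (Pimenov 0 beta 0 gamma)
       (Pimenov 0 (- beta) 0 gamma) (Pimenov 1 0 (- phi) 0).
Proof.
rewrite /pim_galilei_mx -[- (phi *: _)]scaleNr !pim_exp_iota2.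
by congr mx22; congr Pimenov => /=; ring.
Qed.

Lemma mulmx22 (S : pzSemiRingType) (a b c d a' b' c' d' : S) :
  mx22 a b c d *m mx22 a' b' c' d' =
  mx22 (a * a' + b * c') (a * b' + b * d')
       (c * a' + d * c') (c * b' + d * d').
Proof.
apply/matrixP => i j; rewrite !mxE !big_ord_recl big_ord0 addr0 !mxE /=.
by case: ifP => _; case: ifP => _.
Qed.

Lemma det_mx22 (S : comNzRingType) (a b c d : S) :
  \det (mx22 a b c d) = a * d - b * c.
Proof.
rewrite (expand_det_row _ 0) !big_ord_recl big_ord0 addr0 /cofactor.
by rewrite !det_mx11 !mxE /= expr0 expr1 mul1r mulN1r mulrN.
Qed.

Lemma mx22_1 (S : pzSemiRingType) : mx22 1 0 0 1 = 1%:M :> 'M[S]_2.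
Proof.
by apply/matrixP => -[[|[|//]] i] [[|[|//]] j]; rewrite !mxE.
Qed.

Lemma dual_conj_mx22 (x y z t : pimenov R) :
  dual_conj (mx22 x y z t) =
  mx22 (pim_conj x) (pim_conj z) (pim_conj y) (pim_conj t).
Proof.
by apply/matrixP => i j; rewrite !mxE; case: (i == 0); case: (j == 0).
Qed.

(** Products of two off-diagonal entries vanish because [iota1 ^+ 2 = 0]. The cocycle arises where
    the [iota2] part of a diagonal entry meets the [iota1] part of an off-diagonal one; its two
    signs are those of [phi] on the diagonal. *)
Lemma pim_galilei_mxM phi beta gamma phi' beta' gamma' :
  pim_galilei_mx phi beta gamma *m pim_galilei_mx phi' beta' gamma' =
  pim_galilei_mx (phi + phi') (beta + beta')
    (gamma + gamma' + (phi * beta' - beta * phi')).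
Proof.
rewrite !pim_galilei_mxE mulmx22.
by congr mx22; congr Pimenov => /=; ring.
Qed.

Lemma pim_galilei_mx0 : pim_galilei_mx 0 0 0 = 1%:M :> 'M[pimenov R]_2.
Proof. by rewrite pim_galilei_mxE -mx22_1 !oppr0. Qed.

Lemma pim_galilei_mx_inj phi beta gamma phi' beta' gamma' :
  pim_galilei_mx phi beta gamma = pim_galilei_mx phi' beta' gamma' ->
  [/\ phi = phi', beta = beta' & gamma = gamma'].
Proof.
rewrite !pim_galilei_mxE => /matrixP E.
(* The first row already carries all three parameters. *)
by have := E 0 0; have := E 0 1; rewrite !mxE /= => -[-> ->] [->].
Qed.

Lemma det_pim_galilei_mx phi beta gamma :
  \det (pim_galilei_mx phi beta gamma) = 1.
Proof.
by rewrite pim_galilei_mxE det_mx22; congr Pimenov => /=; ring.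
Qed.

Lemma dual_conj_pim_galilei_mx phi beta gamma :
  dual_conj (pim_galilei_mx phi beta gamma) =
  pim_galilei_mx (- phi) (- beta) (- gamma).
Proof.
rewrite !pim_galilei_mxE dual_conj_mx22.
by congr mx22; congr Pimenov => /=; ring.
Qed.

(** The alternating cocycle vanishes on a triple and its opposite. *)
Lemma pim_galilei_mxVM phi beta gamma :
  pim_galilei_mx (- phi) (- beta) (- gamma) *m pim_galilei_mx phi beta gamma =
  1%:M.
Proof.
by rewrite pim_galilei_mxM -pim_galilei_mx0; congr pim_galilei_mx; ring.
Qed.

Lemma pim_galilei_mx_unit phi beta gamma :
  pim_galilei_mx phi beta gamma \in unitmx.
Proof. by rewrite unitmxE det_pim_galilei_mx unitr1. Qed.

Lemma invmx_pim_galilei_mx phi beta gamma :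
  invmx (pim_galilei_mx phi beta gamma) =
  pim_galilei_mx (- phi) (- beta) (- gamma).
Proof.
by rewrite -[LHS]mul1mx -(pim_galilei_mxVM phi beta gamma) mulmxK
   ?pim_galilei_mx_unit.
Qed.

Lemma pim_galilei_mx_special_unitary phi beta gamma :
  pim_galilei_mx phi beta gamma \in special_unitary R.
Proof.
rewrite inE pim_galilei_mx_unit dual_conj_pim_galilei_mx.
by rewrite invmx_pim_galilei_mx det_pim_galilei_mx !eqxx.
Qed.

Definition pim_galilei_SU2 phi beta gamma : SU2 R :=
  MkSU2 (pim_galilei_mx_special_unitary phi beta gamma).

(** A motion only asserts that parameters exist, so they are recovered from the images of two
    points. *)
Definition motion_SU2 (f : motion R) : SU2 R :=
  let: (a, b) := f (0, 0) in
  let theta := (f (1, 0)).2 - b in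
  pim_galilei_SU2 theta a (2%:R * b - theta * a).

Lemma motion_SU2E (f : motion R) a b theta :
  motion_fun f = galilei_map a b theta ->
  motion_SU2 f = pim_galilei_SU2 theta a (2%:R * b - theta * a).
Proof.
by rewrite /motion_SU2 => -> /=; congr pim_galilei_SU2; ring.
Qed.

Arguments motion_SU2E {f a b theta}.

Lemma motion_SU2M : {morph motion_SU2 : f g / (f * g)%g}.
Proof.
move=> f g.
have /asboolP[a [b [t Ef]]] := motionP f.
have /asboolP[a' [b' [t' Eg]]] := motionP g.
rewrite (@motion_SU2E (f * g)%g (a + a') (b + b' + t * a') (t + t')); last first.
  rewrite /= Ef Eg; apply/funext => -[x y].
  by rewrite /galilei_map /=; congr pair; ring.
rewrite (motion_SU2E Ef) (motion_SU2E Eg); apply: val_inj => /=.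
(* Doubling [t * a'] and subtracting [(t + t') * (a + a')] leaves the alternating cross term
   [t * a' - a * t']. *)
by rewrite pim_galilei_mxM; congr pim_galilei_mx; ring.
Qed.

HB.instance Definition _ :=
  isMultiplicative.Build (motion R) (SU2 R) motion_SU2 motion_SU2M.

Lemma motion_SU2_inj : injective motion_SU2.
Proof.
move=> f g.
have /asboolP[a [b [t Ef]]] := motionP f.
have /asboolP[a' [b' [t' Eg]]] := motionP g.
rewrite (motion_SU2E Ef) (motion_SU2E Eg) => /(congr1 val) /pim_galilei_mx_inj.
(* Once [t] and [a] agree, the third equation reduces to [2 * b = 2 * b'], and 2 is nonzero in
   [R]. *)
move=> [et ea]; rewrite et ea => /addIr /mulfI eb.
by apply: val_inj; rewrite /= Ef Eg et ea eb // pnatr_eq0.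
Qed.

Lemma motion_SU2_surj phi beta gamma :
  exists f, motion_SU2 f = pim_galilei_SU2 phi beta gamma.
Proof.
(* The middle parameter solves [gamma = 2 * b - phi * beta] for [b]. *)
have mP : `[< is_motion (galilei_map beta ((gamma + phi * beta) / 2%:R) phi) >].
  by apply/asboolP; do 3 eexists.
exists (MkMotion mP); rewrite (@motion_SU2E (MkMotion mP) _ _ _ erefl).
by congr pim_galilei_SU2; field.
Qed.

End Pimenov.

Arguments motion_SU2E {R f a b theta}.

Theorem proposition3 (R : realType) :
  let G : set (SU2 R) := @SU2val R @^-1` pim_galilei R in
  [/\ pim_galilei R `<=` [set A | A \in special_unitary R],
      group_closed [in G]
    & exists f : {multiplicative motion R -> SU2 R}, set_bij [set: motion R] G f].
Proof.
move=> G; split.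
- by move=> _ [phi [beta [gamma ->]]]; exact: pim_galilei_mx_special_unitary.
- split.
    by rewrite inE; exists 0, 0, 0; rewrite pim_galilei_mx0.
  move=> A B; rewrite !inE => -[p [b [c EA]]] [p' [b' [c' EB]]].
  (* Inversion negates the parameters, so a quotient is again a product of two matrices of the
     family. *)
  rewrite /G /= EA EB invmx_pim_galilei_mx pim_galilei_mxM.
  by do 3 eexists.
- exists (@motion_SU2 R); split.
  + move=> f _; have /asboolP[a [b [t Ef]]] := motionP f.
    by rewrite /= (motion_SU2E Ef); do 3 eexists.
  + by move=> f g _ _; exact: motion_SU2_inj.
  + move=> A [p [b [c EA]]]; have [f Ef] := motion_SU2_surj R p b c.
    by exists f => //=; rewrite Ef; apply: val_inj; rewrite /= EA.
Qed.
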